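(* Let $d$ and $\partial$ be uniformly locally finite metrics on $\mathbb{N}$, and let $E$ and $F$ be strictly convex Banach spaces with $1$-symmetric bases $\mathcal{E}$ and $\mathcal{F}$, respectively. Suppose that $\mathrm{B}_u(d,\mathcal{E})$ and $\mathrm{B}_u(\partial,\mathcal{F})$ are simultaneously order isomorphic and isometric, i.e., there is a linear bijection $\Phi:\mathrm{B}_u(d,\mathcal{E})\to\mathrm{B}_u(\partial,\mathcal{F})$ which is both an order isomorphism and an isometry. Then $(\mathbb{N},d)$ and $(\mathbb{N},\partial)$ are bijectively coarsely equivalent.
   Context: All Banach spaces are complex, and ''basis'' means Schauder basis. For a basis $\mathcal{E}=(e_n)_n$ of $E$, $(e_n^* )_n$ denotes the biorthogonal functionals and $\mathcal{L}(E)$ the bounded operators on $E$. Given a metric $d$ on $\mathbb{N}$, $a\in\mathcal{L}(E)$ is a band operator (with respect to $\mathcal{E}$ and $d$) if there is $r>0$ such that $e_m^*(ae_n)=0$ whenever $d(n,m)>r$. $\mathrm{B}_u[d,\mathcal{E}]$ is the algebra of band operators, and the uniform Roe algebra $\mathrm{B}_u(d,\mathcal{E})$ is its operator-norm closure in $\mathcal{L}(E)$. A metric $d$ on $\mathbb{N}$ is uniformly locally finite if $\sup_{x\in\mathbb{N}}|B_r(x)|<\infty$ for all $r>0$, where $B_r(x)$ is the closed ball of radius $r$ about $x$. Order: $E_+=\{\sum_n a_ne_n\in E: a_n\ge 0\ \forall n\}$; $a\in\mathcal{L}(E)$ is positive if $a(E_+)\subset E_+$, and $a\le b$ means $b-a$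 is positive. $\mathrm{B}_u(d,\mathcal{E})$ carries the order inherited from $\mathcal{L}(E)$. A linear map between ordered Banach spaces is positive if it sends positive elements to positive elements, and is an order isomorphism if it is a positive bijection whose inverse is positive. $\mathcal{E}$ is $1$-unconditional if $\|\sum_{n\le k}\alpha_ne_n\|\le\|\sum_{n\le k}\beta_ne_n\|$ for all $k$ and all scalars with $|\alpha_n|\le|\beta_n|$. $\mathcal{E}$ is $1$-symmetric if it is $1$-unconditional and, for every bijection $\pi:\mathbb{N}\to\mathbb{N}$, $\|\sum_{n\le k}\alpha_ne_n\|=\|\sum_{n\le k}\alpha_ne_{\pi(n)}\|$ for all $k$ and all scalars $\alpha_n$. $E$ is strictly convex if $\|x+y\|<2$ for all distinct unit vectors $x,y\in E$. A map $f:(X,d)\to(Y,\partial)$ is coarse if for all $r>0$ there is $s>0$ such that $d(x,y)<r$ implies $\partial(f(x),f(y))<s$; expanding if for all $s>0$ there is $r>0$ such that $d(x,y)>r$ implies $\partial(f(x),f(y))>s$; a coarse embedding if it is both coarse and expanding; a coarse equivalence if moreover $\sup_{y\in Y}\partial(y,f(X))<\infty$. Two spaces are bijectively coarsely equivalent if there is a bijective coarse equivalence between them. *)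

(* Defs.v *)
From mathcomp Require Import all_boot all_order all_algebra.
From mathcomp Require Import complex.
From mathcomp Require Import all_classical all_reals all_analysis.
Import Order.TTheory GRing.Theory Num.Theory.
Import numFieldNormedType.Exports.

Set Implicit Arguments.
Unset Strict Implicit.
Unset Printing Implicit Defensive.

Local Open Scope classical_set_scope.
Local Open Scope ring_scope.

(* Distances are plain functions rather than [metricType] instances, because
   several metrics live on the same carrier nat. *)
Section Coarse.
Context {R : realType}.

Record is_metric {X : Type} (d : X -> X -> R) : Prop := IsMetric {
  metric_ge0 : forall x y, 0 <= d x y ;
  metric_eq0 : forall x y, d x y = 0 <-> x = y ;
  metric_sym : forall x y, d x y = d y x ;
  metric_triangle : forall x y z, d x z <= d x y + d y z }.

Definition uniformly_locally_finite {X : Type} (d : X -> X -> R) : Prop :=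
  forall r : R, 0 < r ->
    exists N : nat, forall x : X, ([set y | (d x y <= r)%R] #<= `I_N)%card.

Context {X Y : Type}.
Variables (dX : X -> X -> R) (dY : Y -> Y -> R) (f : X -> Y).

Definition coarse_map : Prop :=
  forall r : R, 0 < r -> exists2 s : R, 0 < s &
    forall x y, dX x y < r -> dY (f x) (f y) < s.

Definition expanding_map : Prop :=
  forall s : R, 0 < s -> exists2 r : R, 0 < r &
    forall x y, dX x y > r -> dY (f x) (f y) > s.

Definition coarse_embedding : Prop := coarse_map /\ expanding_map.

Definition dist_to (y : Y) (A : set Y) : \bar R :=
  ereal_inf [set (dY y z)%:E | z in A].

Definition coarse_equivalence : Prop :=
  coarse_embedding /\
  (ereal_sup (range (fun y => dist_to y (range f))) < +oo)%E.

End Coarse.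

Definition bijectively_coarsely_equivalent {R : realType} {X Y : Type}
    (dX : X -> X -> R) (dY : Y -> Y -> R) : Prop :=
  exists2 f : X -> Y, bijective f & coarse_equivalence dX dY f.

Section Basis.
Context {R : realType} {E : completeNormedModType R[i]}.
Implicit Types (e : nat -> E) (x y : E) (a b : E -> E).

(* The norm of a complex normed module has values in R[i], where it is a
   nonnegative real; this is the same norm with values in R. *)
Definition rnorm x : R := complex.Re `|x|.

Definition strictly_convex : Prop :=
  forall x y, rnorm x = 1 -> rnorm y = 1 -> x <> y -> rnorm (x + y) < 2.

Definition expansion e x : set (nat -> R[i]) :=
  [set c | series (fun n => c n *: e n) @ \oo --> x].

Definition schauder_basis e : Prop :=
  forall x, exists! c : nat -> R[i], expansion e x c.

(* e_m^*, the m-th coordinate functional of a Schauder basis. *)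
Definition biorthogonal e (m : nat) (x : E) : R[i] :=
  xget (fun=> 0) (expansion e x) m.

Definition one_unconditional e : Prop :=
  forall (k : nat) (alpha beta : nat -> R[i]),
    (forall n, (n <= k)%N -> `|alpha n| <= `|beta n|) ->
    rnorm (\sum_(n < k.+1) alpha n *: e n)
      <= rnorm (\sum_(n < k.+1) beta n *: e n).

Definition one_symmetric e : Prop :=
  one_unconditional e /\
  forall pi : nat -> nat, bijective pi ->
    forall (k : nat) (alpha : nat -> R[i]),
      rnorm (\sum_(n < k.+1) alpha n *: e n)
        = rnorm (\sum_(n < k.+1) alpha n *: e (pi n)).

Definition bounded_operator a : Prop :=
  linear a /\ exists M : R, forall x, rnorm (a x) <= M * rnorm x.

Definition opnorm a : R := sup [set rnorm (a x) | x in [set x | rnorm x <= 1]].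

Definition band_operators (d : nat -> nat -> R) e : set (E -> E) :=
  [set a | bounded_operator a /\
    exists2 r : R, 0 < r &
      forall n m : nat, d n m > r -> biorthogonal e m (a (e n)) = 0].

Definition uniform_roe_algebra (d : nat -> nat -> R) e : set (E -> E) :=
  [set a | bounded_operator a /\
    forall eps : R, 0 < eps ->
      exists2 b, band_operators d e b & opnorm (a \- b) < eps].

(* In R[i], [0 <= z] means that z is a nonnegative real. *)
Definition positive_cone e : set E :=
  [set x | exists2 c : nat -> R[i], (forall n, 0 <= c n) & expansion e x c].

Definition positive_operator e a : Prop :=
  a @` positive_cone e `<=` positive_cone e.

End Basis.

Arguments strictly_convex {R} E.

Section Isomorphism.
Context {R : realType}.

Definition linear_on {E F : completeNormedModType R[i]}
    (A : set (E -> E)) (Phi : (E -> E) -> F -> F) : Prop :=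
  forall (k : R[i]) (a b : E -> E), A a -> A b ->
    Phi (k *: a + b) = k *: Phi a + Phi b.

Definition positive_on {E F : completeNormedModType R[i]}
    (e : nat -> E) (f : nat -> F)
    (A : set (E -> E)) (Phi : (E -> E) -> F -> F) : Prop :=
  forall a, A a -> positive_operator e a -> positive_operator f (Phi a).

Definition isometry_on {E F : completeNormedModType R[i]}
    (A : set (E -> E)) (Phi : (E -> E) -> F -> F) : Prop :=
  forall a, A a -> opnorm (Phi a) = opnorm a.

Definition order_isomorphism {E F : completeNormedModType R[i]}
    (e : nat -> E) (f : nat -> F) (A : set (E -> E)) (B : set (F -> F))
    (Phi : (E -> E) -> F -> F) : Prop :=
  [/\ linear_on A Phi, set_bij A B Phi, positive_on e f A Phi &
    exists Psi : (F -> F) -> E -> E,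
      [/\ set_bij B A Psi,
          forall a, A a -> Psi (Phi a) = a,
          forall b, B b -> Phi (Psi b) = b &
          positive_on f e B Psi]].

Definition order_isometric {E F : completeNormedModType R[i]}
    (e : nat -> E) (f : nat -> F)
    (A : set (E -> E)) (B : set (F -> F)) : Prop :=
  exists2 Phi : (E -> E) -> F -> F,
    order_isomorphism e f A B Phi & isometry_on A Phi.

End Isomorphism.

(* Main.v *)
Require Import Defs.
From mathcomp Require Import all_boot all_order all_algebra.
From mathcomp Require Import complex.
From mathcomp Require Import all_classical all_reals all_analysis.
From mathcomp Require Import lra zify.
Import Order.TTheory GRing.Theory Num.Theory.
Import numFieldNormedType.Exports.

Set Implicit Arguments.
Unset Strict Implicit.
Unset Printing Implicit Defensive.

Local Open Scope classical_set_scope.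
Local Open Scope ring_scope.

(** A matrix unit [e_ij] is an atom of norm one of the cone of positive
    operators, so an isometric order isomorphism sends it to a matrix unit in
    some position [sigma (i, j)]. For distinct positions the norm of
    [e_ij + e_kl] exceeds [1] when they lie on a common line, by strict
    convexity, and is at most [1] otherwise, by symmetry of the basis. Hence
    [sigma] is an automorphism of the rook's graph, that is, a product of two
    bijections [al] and [be], possibly followed by a transposition.
    If [s] is a partial injection moving points by at most [r], then the partial
    translation [x |-> \sum_n x_n e_(s n)] is a positive band operator dominating
    the matrix units in positions [(s n, n)]; its image dominates their images
    and has small entries far from the diagonal, so [al (s n)] and [be n] stay at
    bounded distance. The choice [s = id] shows that [al] and [be] are close, so
    [al] is coarse; the inverse isomorphism shows that [al^-1] is coarse. *)

(** * Norms and moduli with values in [R], and convergence of sequences *)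

Section RealNorm.
Context {R : realType} {E : completeNormedModType R[i]}.
Implicit Types (x y : E) (k : R[i]) (u v : nat -> E).

(** The counterpart of [rnorm] for scalars; estimates can then be carried out in the ordered field
    [R]. *)
Definition cabs k : R := complex.Re `|k|.

Lemma norm_rnorm x : `|x| = (rnorm x)%:C%C.
Proof. by rewrite /rnorm RRe_real // normr_real. Qed.

Lemma norm_cabs k : `|k| = (cabs k)%:C%C.
Proof. by rewrite /cabs RRe_real // normr_real. Qed.

Lemma rnorm_ge0 x : 0 <= rnorm x.
Proof. by rewrite -lecR -norm_rnorm normr_ge0. Qed.

Lemma cabs_ge0 k : 0 <= cabs k.
Proof. by rewrite -lecR -norm_cabs normr_ge0. Qed.

Lemma rnorm0 : rnorm (0 : E) = 0.
Proof. by rewrite /rnorm normr0. Qed.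

Lemma rnorm0_eq0 x : rnorm x = 0 -> x = 0.
Proof. by move=> x0; apply/normr0_eq0; rewrite norm_rnorm x0. Qed.

Lemma cabs0_eq0 k : cabs k = 0 -> k = 0.
Proof. by move=> k0; apply/normr0_eq0; rewrite norm_cabs k0. Qed.

Lemma rnormN x : rnorm (- x) = rnorm x.
Proof. by rewrite /rnorm normrN. Qed.

Lemma rnormD x y : rnorm (x + y) <= rnorm x + rnorm y.
Proof.
by rewrite -lecR raddfD /= -!norm_rnorm; exact: ler_normD.
Qed.

Lemma rnormB x y : rnorm (x - y) <= rnorm x + rnorm y.
Proof. by rewrite -(rnormN y); exact: rnormD. Qed.

Lemma rnormZ k x : rnorm (k *: x) = cabs k * rnorm x.
Proof.
by apply: complexI; rewrite rmorphM /= -!norm_rnorm -norm_cabs normrZ.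
Qed.

Lemma cabsM k k' : cabs (k * k') = cabs k * cabs k'.
Proof.
by apply: complexI; rewrite rmorphM /= -!norm_cabs normrM.
Qed.

Lemma cabsD k k' : cabs (k + k') <= cabs k + cabs k'.
Proof. by rewrite -lecR raddfD /= -!norm_cabs; exact: ler_normD. Qed.

Lemma cabs_real (r : R) : 0 <= r -> cabs (r%:C)%C = r.
Proof. by move=> r0; rewrite /cabs ger0_norm // lecR. Qed.

Lemma cabs1 : cabs 1 = 1.
Proof. by rewrite /cabs normr1. Qed.

(** Convergence tested on real [eps] only; [norm_cvgP] identifies it with filter convergence, which
    quantifies over the positive elements of [R[i]]. *)
Definition norm_cvg u x := forall eps : R, 0 < eps ->
  exists N, forall n, (N <= n)%N -> rnorm (x - u n) < eps.

Lemma norm_cvgP u x : u @ \oo --> x <-> norm_cvg u x.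
Proof.
split=> [/cvgrPdist_lt ux eps eps0|ux].
  have /ux[N _ uN] : 0 < (eps%:C)%C by rewrite ltcR.
  by exists N => n Nn; rewrite -ltcR -norm_rnorm; exact: uN.
apply/cvgrPdist_lt => eps eps0.
have epsR : eps = ((complex.Re eps)%:C)%C by rewrite RRe_real // gtr0_real.
have /ux[N uN] : 0 < complex.Re eps by rewrite -ltcR -epsR.
by exists N => // n /= /uN; rewrite epsR norm_rnorm ltcR.
Qed.

Lemma norm_cvg_eventually u x N :
  (forall n, (N <= n)%N -> u n = x) -> norm_cvg u x.
Proof.
by move=> ux eps eps0; exists N => n /ux ->; rewrite subrr rnorm0.
Qed.

Lemma norm_cvg_unique u x y : norm_cvg u x -> norm_cvg u y -> x = y.
Proof.
move=> /norm_cvgP ux /norm_cvgP uy.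
by rewrite -(cvg_lim (@norm_hausdorff _ _) ux) (cvg_lim (@norm_hausdorff _ _) uy).
Qed.

Lemma norm_cvgZD k u v x y : norm_cvg u x -> norm_cvg v y ->
  norm_cvg (fun n => k *: u n + v n) (k *: x + y).
Proof.
move=> ux vy eps eps0.
(* Dividing by [cabs k + 1] rather than [cabs k] covers the case [k = 0]. *)
have k1 : 0 < cabs k + 1 by rewrite ltr_wpDl // cabs_ge0.
have /ux[N1 uN] : 0 < eps / 2 / (cabs k + 1) by rewrite !divr_gt0.
have /vy[N2 vN] : 0 < eps / 2 by rewrite divr_gt0.
exists (maxn N1 N2) => n; rewrite geq_max => /andP[/uN un /vN vn].
rewrite opprD addrACA -scalerBr.
apply: le_lt_trans (rnormD _ _) _; rewrite rnormZ [ltRHS](splitr eps) ler_ltD //.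
have {}un := ltW un; have uge := rnorm_ge0 (x - u n).
rewrite ler_pdivlMr // in un; apply: le_trans un.
by rewrite mulrC ler_wpM2l // lerDl.
Qed.

(** Completeness of [E] enters here; it makes the series defining partial translations converge. *)
Lemma norm_cauchy_cvg (c : nat -> E) :
  (forall eps : R, 0 < eps -> exists N, forall m n, (N <= m)%N -> (m <= n)%N ->
    rnorm (\sum_(m <= k < n) c k) < eps) ->
  exists x, norm_cvg (series c) x.
Proof.
move=> hc; suff /cauchy_cvgP/cvg_ex[x cx] : cauchy (series c @ \oo).
  by exists x; apply/norm_cvgP.
apply/cauchy_seriesP => eps eps0.
have epsR : eps = ((complex.Re eps)%:C)%C by rewrite RRe_real // gtr0_real.
have /hc[N cN] : 0 < complex.Re eps by rewrite -ltcR -epsR.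
exists ([set m | (N <= m)%N], [set m | (N <= m)%N]) => /=.
  by split; exact: nbhs_infty_ge.
move=> [m n] /= [Nm Nn]; rewrite epsR norm_rnorm ltcR.
have [mn|nm] := leqP m n; first exact: cN.
by rewrite big_geq ?rnorm0 -?ltcR -?epsR // ltnW.
Qed.

End RealNorm.

(** Lets norm inequalities between finite partial sums pass to the limit. *)
Lemma norm_cvg_le {R : realType} {E F : completeNormedModType R[i]}
    (u : nat -> E) (w : nat -> F) (x : E) (y : F) (c : R) (N : nat) :
  norm_cvg u x -> norm_cvg w y -> 0 <= c ->
  (forall n, (N <= n)%N -> rnorm (u n) <= c * rnorm (w n)) ->
  rnorm x <= c * rnorm y.
Proof.
move=> ux wy c0 uw; apply/ler_addgt0Pr => eps eps0.
have c1 : 0 < c + 1 by rewrite ltr_wpDl.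
have /ux[N1 uN] : 0 < eps / 2 by rewrite divr_gt0.
have /wy[N2 wN] : 0 < eps / 2 / (c + 1) by rewrite !divr_gt0.
pose n := maxn N (maxn N1 N2).
have {uN}un : rnorm (x - u n) < eps / 2 by apply: uN; rewrite /n; lia.
have {wN}wn : rnorm (y - w n) < eps / 2 / (c + 1) by apply: wN; rewrite /n; lia.
have {}uw : rnorm (u n) <= c * rnorm (w n) by apply: uw; rewrite /n; lia.
have h1 : rnorm x <= rnorm (x - u n) + rnorm (u n).
  by rewrite -{1}(subrK (u n) x) rnormD.
have h2 : rnorm (w n) <= rnorm y + rnorm (y - w n).
  have -> : rnorm (w n) = rnorm (y - (y - w n)) by rewrite subKr.
  exact: rnormB.
have h3 : c * rnorm (w n) <= c * rnorm y + c * rnorm (y - w n).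
  by rewrite -mulrDr ler_wpM2l.
have h4 : c * rnorm (y - w n) <= eps / 2.
  have := ltW wn; rewrite ler_pdivlMr // mulrC; apply: le_trans.
  by rewrite ler_wpM2r ?rnorm_ge0 // lerDl.
lra.
Qed.

(** * Coordinate functionals of a Schauder basis *)

Section Coordinates.
Context {R : realType} {E : completeNormedModType R[i]} {e : nat -> E}.
Hypothesis e_basis : schauder_basis e.
Implicit Types (x y : E) (c : nat -> R[i]).

Local Notation coord := (biorthogonal e).

Lemma expansion_coord x : expansion e x (fun n => coord n x).
Proof.
have [c [cx _]] := e_basis x.
by rewrite /biorthogonal; exact: (@xgetI _ (fun=> 0) (expansion e x) c cx).
Qed.

Lemma expansion_unique x c : expansion e x c -> forall n, coord n x = c n.
Proof.
move=> cx n; have [c' [_ c'U]] := e_basis x.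
have <- := c'U _ cx.
by rewrite (c'U _ (@expansion_coord x)).
Qed.

Definition psum x (n : nat) : E := \sum_(i < n) coord i x *: e i.

Lemma psum_cvg x : norm_cvg (psum x) x.
Proof.
apply/norm_cvgP; suff -> : psum x = series (fun n => coord n x *: e n).
  exact: expansion_coord.
by apply/funext => n; rewrite /series /= big_mkord.
Qed.

Lemma coord_unique x c :
  norm_cvg (fun n => \sum_(i < n) c i *: e i) x -> forall n, coord n x = c n.
Proof.
move=> /norm_cvgP cx; apply: expansion_unique; rewrite /expansion /=.
suff -> : series (fun n => c n *: e n) = fun n => \sum_(i < n) c i *: e i by [].
by apply/funext => n; rewrite /series /= big_mkord.
Qed.

(** The combination of the two expansions converges to [k *: x + y], so by uniqueness it is the
    expansion of that vector. *)
Lemma coordP k x y n : coord n (k *: x + y) = k * coord n x + coord n y.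
Proof.
apply: (@coord_unique _ (fun n => k * coord n x + coord n y)).
have := norm_cvgZD k (psum_cvg x) (psum_cvg y).
congr norm_cvg; apply/funext => m.
rewrite /psum scaler_sumr -big_split /=; apply: eq_bigr => i _.
by rewrite scalerDl scalerA.
Qed.

Lemma coord0 n : coord n 0 = 0.
Proof.
have := coordP (-1) 0 0 n.
by rewrite scaler0 addr0 mulN1r addNr.
Qed.

Lemma coordD x y n : coord n (x + y) = coord n x + coord n y.
Proof. by rewrite -{1}(scale1r x) coordP mul1r. Qed.

Lemma coordZ k x n : coord n (k *: x) = k * coord n x.
Proof. by rewrite -(addr0 (k *: x)) coordP coord0 addr0. Qed.

Lemma coordB x y n : coord n (x - y) = coord n x - coord n y.
Proof. by rewrite addrC -scaleN1r coordP mulN1r addrC. Qed.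

Lemma coord_sum (I : Type) (r : seq I) (P : pred I) (F : I -> E) n :
  coord n (\sum_(i <- r | P i) F i) = \sum_(i <- r | P i) coord n (F i).
Proof. by apply: big_morph => [x y|]; [exact: coordD|exact: coord0]. Qed.

Lemma coord_basis m n : coord m (e n) = (m == n)%:R.
Proof.
apply: (@coord_unique _ (fun m => (m == n)%:R)).
apply: (@norm_cvg_eventually _ _ _ _ n.+1) => k nk.
rewrite (bigD1 (Ordinal nk)) //= eqxx scale1r big1 ?addr0 // => i.
by rewrite -val_eqE /= => /negbTE ->; rewrite scale0r.
Qed.

Lemma coord_ext x y : (forall n, coord n x = coord n y) -> x = y.
Proof.
move=> xy; apply: norm_cvg_unique (psum_cvg x) _.
suff -> : psum x = psum y by exact: psum_cvg.
by apply/funext => n; apply: eq_bigr => i _; rewrite xy.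
Qed.

Lemma basis_neq0 n : e n != 0.
Proof.
apply/eqP => en0; have := coord_basis n n.
by rewrite en0 coord0 eqxx => /esym/eqP; rewrite oner_eq0.
Qed.

End Coordinates.

(** * Norm estimates for a 1-symmetric basis *)

Section SymmetricBasis.
Context {R : realType} {E : completeNormedModType R[i]} {e : nat -> E}.
Hypotheses (e_basis : schauder_basis e) (e_sym : one_symmetric e).
Implicit Types (x y : E) (c : nat -> R[i]).

Local Notation coord := (biorthogonal e).
Local Notation psum := (psum (e := e)).

Lemma sum_mono k (a b : nat -> R[i]) :
  (forall n, (n < k)%N -> `|a n| <= `|b n|) ->
  rnorm (\sum_(n < k) a n *: e n) <= rnorm (\sum_(n < k) b n *: e n).
Proof.
case: k => [|k] ab; first by rewrite !big_ord0.
by apply: e_sym.1 => n; rewrite -ltnS; exact: ab.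
Qed.

Lemma sum_perm (pi : nat -> nat) : bijective pi -> forall k c,
  rnorm (\sum_(n < k) c n *: e n) = rnorm (\sum_(n < k) c n *: e (pi n)).
Proof.
move=> pibij [|k] c; first by rewrite !big_ord0.
exact: e_sym.2.
Qed.

(** The transposition of [a] and [b]. *)
Definition nswap (a b n : nat) : nat :=
  if n == a then b else if n == b then a else n.

Lemma nswapK a b : involutive (nswap a b).
Proof.
move=> n; rewrite /nswap; case: (eqVneq n a) => [->|na].
  by case: eqVneq => [//|]; rewrite eqxx.
case: (eqVneq n b) => [->|nb]; first by rewrite eqxx.
by rewrite (negbTE na) (negbTE nb).
Qed.

Lemma nswap_bij a b : bijective (nswap a b).
Proof. by exists (nswap a b); exact: nswapK. Qed.

(** Only the values below [k] are prescribed: an injection of the integers need not be onto, but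
    symmetry is applied to finite sums only. The induction corrects the value at [k] by a
    transposition, which by injectivity leaves the earlier prescribed values alone. *)
Lemma injection_extend (D : pred nat) (s : nat -> nat) :
  {in D &, injective s} -> forall k, exists2 pi : nat -> nat, bijective pi &
    forall n, (n < k)%N -> D n -> pi n = s n.
Proof.
move=> sinj; elim=> [|k [pi pibij pis]].
  by exists id => //; exists id.
have [Dk|nDk] := boolP (D k); last first.
  exists pi => // n; rewrite ltnS leq_eqVlt => /predU1P[->|]; last exact: pis.
  by rewrite (negbTE nDk).
exists (nswap (pi k) (s k) \o pi).
  exact: bij_comp (nswap_bij _ _) pibij.
move=> n /=; rewrite ltnS leq_eqVlt => /predU1P[-> _|nk Dn].
  by rewrite /nswap eqxx.
rewrite /nswap (inj_eq (bij_inj pibij)) (ltn_eqF nk) pis //.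
case: eqP => // snk; have nk' := sinj n k Dn Dk snk.
by rewrite nk' ltnn in nk.
Qed.

Lemma norm_basis n : rnorm (e n) = rnorm (e 0%N).
Proof.
have := sum_perm (nswap_bij 0 n) 1 (fun=> 1).
by rewrite !big_ord1 !scale1r /= /nswap eqxx.
Qed.

Lemma norm_basis_gt0 n : 0 < rnorm (e n).
Proof.
rewrite lt_def rnorm_ge0 andbT; apply/eqP => /rnorm0_eq0 en0.
by have := basis_neq0 e_basis n; rewrite en0 eqxx.
Qed.

(** Unconditionality for finite sums, carried over to the limits of the partial sums. *)
Lemma norm_coord_mono x y :
  (forall n, `|coord n x| <= `|coord n y|) -> rnorm x <= rnorm y.
Proof.
move=> xy; rewrite -[leRHS]mul1r.
apply: (norm_cvg_le (psum_cvg e_basis x) (psum_cvg e_basis y) ler01 (N := 0)).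
by move=> n _; rewrite mul1r; apply: sum_mono => m _; exact: xy.
Qed.

Lemma norm_coord n x : cabs (coord n x) * rnorm (e 0%N) <= rnorm x.
Proof.
rewrite -(norm_basis n) -rnormZ; apply: norm_coord_mono => m.
rewrite coordZ // coord_basis //.
by case: eqP => [->|]; rewrite (mulr1, mulr0) ?normr0.
Qed.

(** Coordinates are continuous by [norm_coord], and the condition [0 <= z] is the closed condition
    that [z] equals its modulus. *)
Lemma coord_ge0_closed (u : nat -> E) x n :
  norm_cvg u x -> (forall k, 0 <= coord n (u k)) -> 0 <= coord n x.
Proof.
move=> ux u0; rewrite ger0_def; apply/eqP; set z := coord n x.
suff : cabs (`|z| - z) = 0 by move/cabs0_eq0/eqP; rewrite subr_eq0 => /eqP.
apply/eqP; rewrite eq_le cabs_ge0 andbT; apply/ler_addgt0Pr => eps eps0.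
have e0 := norm_basis_gt0 0; rewrite add0r.
have /ux[N uN] : 0 < eps / 2 * rnorm (e 0%N) by rewrite !mulr_gt0 ?invr_gt0.
have {uN} := uN _ (leqnn N); set w := coord n (u N).
move/(le_lt_trans (norm_coord n _)); rewrite coordB // -/z -/w.
rewrite ltr_pM2r // => /ltW zw.
(* Since [w] is its own modulus, inserting it splits the difference into two terms, each of modulus
   at most that of [z - w]. *)
have -> : `|z| - z = (`|z| - `|w|) + (w - z).
  by rewrite [`|w|]ger0_norm ?u0 // addrA subrK.
apply: le_trans (cabsD _ _) _; rewrite (splitr eps) lerD //.
  apply: le_trans zw; rewrite -lecR -!norm_cabs; exact: ler_dist_dist.
by apply: le_trans zw; rewrite /cabs distrC.
Qed.

End SymmetricBasis.

(** * Bounded operators and the operator norm *)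

Section Operators.
Context {R : realType} {E : completeNormedModType R[i]}.
Implicit Types (a b : E -> E) (x y : E) (k : R[i]).

Lemma lin0 a : linear a -> a 0 = 0.
Proof. by move=> al; have := al (-1) 0 0; rewrite scaler0 addr0 scaleN1r addNr. Qed.

Lemma linZ a k x : linear a -> a (k *: x) = k *: a x.
Proof. by move=> al; have := al k x 0; rewrite (lin0 al) !addr0. Qed.

Lemma lin_sum a (I : Type) (r : seq I) (P : pred I) (F : I -> E) : linear a ->
  a (\sum_(i <- r | P i) F i) = \sum_(i <- r | P i) a (F i).
Proof.
move=> al; apply: big_morph => [x y|]; last exact: lin0.
by have := al 1 x y; rewrite !scale1r.
Qed.

Lemma bounded_operatorZD k a b :
  bounded_operator a -> bounded_operator b -> bounded_operator (k *: a + b).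
Proof.
move=> [al [Ma aM]] [bl [Mb bM]]; split.
  move=> c x y /=; rewrite !fctE /= al bl !scalerDr !scalerA [k * c]mulrC.
  by rewrite -!addrA; congr (_ + _); rewrite addrCA.
exists (cabs k * Ma + Mb) => x; rewrite !fctE /= mulrDl -mulrA.
by apply: le_trans (rnormD _ _) _; rewrite rnormZ lerD // ler_wpM2l ?cabs_ge0.
Qed.

Lemma le_opnorm a x : bounded_operator a -> rnorm (a x) <= opnorm a * rnorm x.
Proof.
move=> [al [M aM]].
have [x0|xN0] := eqVneq (rnorm x) 0.
  by rewrite (rnorm0_eq0 x0) (lin0 al) rnorm0 mulr0.
have x0 : 0 < rnorm x by rewrite lt_def xN0 rnorm_ge0.
(* [opnorm] is a supremum over the unit ball, so [x] is first scaled to norm one. *)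
pose t : R[i] := (((rnorm x)^-1)%:C)%C.
have tE : cabs t = (rnorm x)^-1 by rewrite cabs_real // invr_ge0 ltW.
rewrite -ler_pdivrMr // mulrC -tE -rnormZ -linZ //.
apply: ub_le_sup; last first.
  by exists (t *: x) => //=; rewrite rnormZ tE mulVf.
exists `|M| => _ /= [y y1 <-]; apply: le_trans (aM y) _.
apply: le_trans (_ : `|M| * rnorm y <= _).
  by rewrite ler_wpM2r ?rnorm_ge0 // ler_norm.
by rewrite -[leRHS]mulr1 ler_wpM2l.
Qed.

Lemma opnorm_le a (M : R) : linear a -> 0 <= M ->
  (forall x, rnorm (a x) <= M * rnorm x) -> opnorm a <= M.
Proof.
move=> al M0 aM; apply: ge_sup.
  by exists 0; exists 0; rewrite /= ?rnorm0 // (lin0 al) rnorm0.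
move=> _ /= [x x1 <-]; apply: le_trans (aM x) _.
by rewrite -[leRHS]mulr1 ler_wpM2l.
Qed.

Lemma opnorm_ge0 a : bounded_operator a -> 0 <= opnorm a.
Proof.
move=> [al [M aM]]; apply: ub_le_sup; last first.
  by exists 0; rewrite /= ?(lin0 al) rnorm0.
exists `|M| => _ /= [y y1 <-]; apply: le_trans (aM y) _.
apply: le_trans (_ : `|M| * rnorm y <= _).
  by rewrite ler_wpM2r ?rnorm_ge0 // ler_norm.
by rewrite -[leRHS]mulr1 ler_wpM2l.
Qed.

Lemma opnormZD k a b : bounded_operator a -> bounded_operator b ->
  opnorm (k *: a + b) <= cabs k * opnorm a + opnorm b.
Proof.
move=> ab bb; apply: opnorm_le.
- exact: (bounded_operatorZD k ab bb).1.
- by rewrite addr_ge0 ?mulr_ge0 ?cabs_ge0 ?opnorm_ge0.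
- move=> x; rewrite !fctE /=; apply: le_trans (rnormD _ _) _.
  rewrite rnormZ mulrDl -mulrA lerD ?le_opnorm //.
  by rewrite ler_wpM2l ?cabs_ge0 ?le_opnorm.
Qed.

Lemma bounded_operator0 : bounded_operator (0 : E -> E).
Proof.
rewrite (_ : 0 = cst 0) //; split=> [c x y|]; first by rewrite scaler0 addr0.
by exists 0 => x; rewrite rnorm0 mul0r.
Qed.

Lemma bounded_operatorZ k a : bounded_operator a -> bounded_operator (k *: a).
Proof.
by rewrite -[k *: a]addr0 => ab; exact: (bounded_operatorZD k ab bounded_operator0).
Qed.

Lemma opnormZ k a : bounded_operator a -> opnorm (k *: a) = cabs k * opnorm a.
Proof.
have opZ c b : bounded_operator b -> opnorm (c *: b) <= cabs c * opnorm b.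
  move=> bb; apply: opnorm_le.
  - exact: (bounded_operatorZ c bb).1.
  - by rewrite mulr_ge0 ?cabs_ge0 ?opnorm_ge0.
  - by move=> x; rewrite fctE rnormZ -mulrA ler_wpM2l ?cabs_ge0 ?le_opnorm.
move=> ab; apply/eqP; rewrite eq_le opZ //=.
have [->|k0] := eqVneq k 0.
  rewrite {1}/cabs normr0 mul0r.
  exact/opnorm_ge0/bounded_operatorZ.
(* The reverse inequality is [opZ] applied to [k^-1] and [k *: a]. *)
have := opZ k^-1 _ (bounded_operatorZ k ab).
rewrite scalerA mulVf // scale1r => aka.
have ck : 0 <= cabs k := cabs_ge0 k.
apply: le_trans (ler_wpM2l ck aka) _.
by rewrite mulrA -cabsM mulfV // cabs1 mul1r.
Qed.

Lemma norm_cvg_op a (u : nat -> E) x :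
  bounded_operator a -> norm_cvg u x -> norm_cvg (a \o u) (a x).
Proof.
move=> ab ux eps eps0; have a1 : 0 < opnorm a + 1.
  by rewrite ltr_wpDl // opnorm_ge0.
have /ux[N uN] : 0 < eps / (opnorm a + 1) by rewrite divr_gt0.
exists N => n /uN; rewrite ltr_pdivlMr // => un.
have -> : a x - (a \o u) n = a (x - u n).
  by have := ab.1 (-1) (u n) x; rewrite !scaleN1r addrC [- u n + x]addrC => ->.
apply: le_lt_trans (le_opnorm _ ab) _; apply: le_lt_trans un.
by rewrite mulrC ler_wpM2l ?rnorm_ge0 // lerDl.
Qed.

End Operators.

(** * Matrix entries of bounded operators *)

Section Entries.
Context {R : realType} {E : completeNormedModType R[i]} {e : nat -> E}.
Hypotheses (e_basis : schauder_basis e) (e_sym : one_symmetric e).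
Implicit Types (a b : E -> E) (x y : E) (k : R[i]).

Local Notation coord := (biorthogonal e).

Lemma op_series a x : bounded_operator a ->
  norm_cvg (fun n => \sum_(i < n) coord i x *: a (e i)) (a x).
Proof.
move=> ab; have := norm_cvg_op ab (psum_cvg e_basis x).
congr norm_cvg; apply/funext => n /=; rewrite (lin_sum _ _ _ ab.1).
by apply: eq_bigr => i _; rewrite (linZ _ _ ab.1).
Qed.

Lemma op_ext a b : bounded_operator a -> bounded_operator b ->
  (forall n, a (e n) = b (e n)) -> a = b.
Proof.
move=> ab bb e_ab; apply/funext => x; apply: norm_cvg_unique (op_series x ab) _.
by under eq_fun do under eq_bigr do rewrite e_ab; exact: op_series.
Qed.

(** Basis vectors lie in the cone, which gives one direction. Conversely [a x] is a limit of
    nonnegative combinations of columns, and nonnegative coordinates survive limits. *)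
Lemma positive_operatorP a : bounded_operator a ->
  positive_operator e a <-> forall m n, 0 <= coord m (a (e n)).
Proof.
move=> ab; split=> [apos m n|apos _ [x [c c0 xc] <-]].
  have : positive_cone e (e n).
    exists (fun m => coord m (e n)); last exact: expansion_coord.
    by move=> j; rewrite coord_basis // ler0n.
  move=> epos; have [c c0 /(expansion_unique e_basis) ->//] : positive_cone e (a (e n)).
  by apply: apos; exists (e n).
exists (fun m => coord m (a x)); last exact: expansion_coord.
move=> m; apply: (coord_ge0_closed e_basis e_sym (op_series x ab)) => n.
rewrite coord_sum // sumr_ge0 // => i _.
by rewrite coordZ // mulr_ge0 // (expansion_unique e_basis xc).
Qed.

Lemma entry_le_opnorm a m n :
  bounded_operator a -> cabs (coord m (a (e n))) <= opnorm a.
Proof.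
move=> ab; have e0 := norm_basis_gt0 e_basis 0.
rewrite -(ler_pM2r e0) -{2}(norm_basis e_sym n).
by apply: le_trans (norm_coord e_basis e_sym m _) _; exact: le_opnorm.
Qed.

End Entries.

(** * Partial translations, matrix units and norms of their sums *)

Section PartialTranslations.
Context {R : realType} {E : completeNormedModType R[i]} {e : nat -> E}.
Hypotheses (e_basis : schauder_basis e) (e_sym : one_symmetric e).
Implicit Types (x y : E).

Local Notation coord := (biorthogonal e).
Local Notation psum := (psum (e := e)).

(** On the finitely many indices of the sum, [s] agrees on [D] with a bijection, to which symmetry
    applies; outside [D] the terms vanish. *)
Lemma norm_sum_injection (D : pred nat) (s : nat -> nat) (c : nat -> R[i]) k :
  {in D &, injective s} -> (forall n, ~~ D n -> c n = 0) ->
  rnorm (\sum_(n < k) c n *: e (s n)) = rnorm (\sum_(n < k) c n *: e n).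
Proof.
move=> sinj c0; have [pi pibij pis] := injection_extend sinj k.
rewrite (sum_perm e_sym pibij); congr rnorm; apply: eq_bigr => n _.
by have [Dn|/c0 ->] := boolP (D n); rewrite ?scale0r // pis.
Qed.

Section Translation.
Variables (D : pred nat) (s : nat -> nat).
Hypothesis s_inj : {in D &, injective s}.

Definition on_domain x (n : nat) : R[i] := if D n then coord n x else 0.

(** [xget] selects the limit of the series. When [s] is injective on [D] the default [0] is never
    taken, by [translation_cvg]. *)
Definition translation x : E :=
  xget 0 [set y | norm_cvg (series (fun n => on_domain x n *: e (s n))) y].

(** Blocks of this series have norm at most that of the same blocks of the expansion of [x], which
    is Cauchy. *)
Lemma translation_cvg x :
  norm_cvg (series (fun n => on_domain x n *: e (s n))) (translation x).
Proof.
suff [y xy] : exists y, norm_cvg (series (fun n => on_domain x n *: e (s n))) y.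
  by rewrite /translation; exact: (@xgetI _ 0 _ y xy).
apply: norm_cauchy_cvg => eps eps0.
have /(psum_cvg e_basis x)[N xN] : 0 < eps / 2 by rewrite divr_gt0.
exists N => m n Nm mn.
(* Padding with zeros turns the block from [m] to [n] into an initial sum, the form in which
   symmetry and unconditionality are stated. *)
pose tail c i : R[i] := if (m <= i)%N then c i else 0.
have tailE c (v : nat -> E) :
    \sum_(m <= i < n) c i *: v i = \sum_(i < n) tail c i *: v i.
  rewrite big_geq_mkord big_mkcond; apply: eq_bigr => i _.
  by rewrite /tail /=; case: (m <= i)%N; rewrite ?scale0r.
rewrite tailE (@norm_sum_injection D) //; last first.
  by move=> i /negbTE Di; rewrite /tail /on_domain Di if_same.
apply: (@le_lt_trans _ _ (rnorm (\sum_(i < n) tail (coord^~ x) i *: e i))).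
  apply: (sum_mono e_sym) => i _; rewrite /tail /on_domain.
  by case: (m <= i)%N => //; case: (D i); rewrite // normr0.
rewrite -tailE.
have -> : \sum_(m <= i < n) coord i x *: e i = (x - psum x m) - (x - psum x n).
  rewrite opprB addrC addrA subrK /psum -!(big_mkord xpredT (fun i => coord i x *: e i)).
  by rewrite [X in _ = X - _](big_cat_nat _ mn) //= [X in X - _]addrC addrK.
apply: le_lt_trans (rnormB _ _) _; rewrite (splitr eps).
by rewrite ltrD ?xN ?(leq_trans Nm).
Qed.

Lemma translation_linear : linear translation.
Proof.
move=> k x y; apply: norm_cvg_unique (translation_cvg _) _.
have := norm_cvgZD k (translation_cvg x) (translation_cvg y).
congr norm_cvg; apply/funext => n.
rewrite /series /= scaler_sumr -big_split; apply: eq_bigr => i _ /=.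
rewrite scalerA -scalerDl /on_domain; case: (D i); first by rewrite coordP.
by rewrite mulr0 addr0.
Qed.

Lemma norm_translation x : rnorm (translation x) <= rnorm x.
Proof.
rewrite -[leRHS]mul1r.
apply: (norm_cvg_le (translation_cvg x) (psum_cvg e_basis x) ler01 (N := 0)).
move=> n _; rewrite mul1r /series /= big_mkord (@norm_sum_injection D) //.
  apply: (sum_mono e_sym) => i _; rewrite /on_domain.
  by case: (D i); rewrite // normr0.
by move=> i /negbTE Di; rewrite /on_domain Di.
Qed.

Lemma translation_bounded : bounded_operator translation.
Proof.
split; first exact: translation_linear.
by exists 1 => x; rewrite mul1r norm_translation.
Qed.

Lemma opnorm_translation : opnorm translation <= 1.
Proof.
apply: opnorm_le => //; first exact: translation_linear.
by move=> x; rewrite mul1r norm_translation.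
Qed.

Lemma translation_basis n : translation (e n) = if D n then e (s n) else 0.
Proof.
apply: norm_cvg_unique (translation_cvg _) _.
apply: (@norm_cvg_eventually _ _ _ _ n.+1) => k nk.
rewrite /series /= big_mkord (bigD1 (Ordinal nk)) //= big1 ?addr0.
  rewrite /on_domain coord_basis // eqxx.
  by case: (D n); rewrite (scale0r, scale1r).
move=> i; rewrite -val_eqE /= => /negbTE ni.
by rewrite /on_domain coord_basis // ni if_same scale0r.
Qed.

End Translation.

(** The first component of [p] is the row and the second the column. *)
Definition matrix_unit (p : nat * nat) (x : E) : E := coord p.2 x *: e p.1.

Lemma matrix_unit_basis p n :
  matrix_unit p (e n) = if p.2 == n then e p.1 else 0.
Proof.
by rewrite /matrix_unit coord_basis //; case: eqP; rewrite (scale1r, scale0r).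
Qed.

Lemma matrix_unit_entry p m n :
  coord m (matrix_unit p (e n)) = ((m, n) == p)%:R.
Proof.
case: p => i j; rewrite matrix_unit_basis xpair_eqE /= [n == j]eq_sym.
by case: eqP => _; rewrite ?coord_basis ?coord0 // ?andbT ?andbF.
Qed.

Lemma norm_matrix_unit p x : rnorm (matrix_unit p x) <= rnorm x.
Proof. by rewrite rnormZ norm_basis // norm_coord. Qed.

Lemma matrix_unit_bounded p : bounded_operator (matrix_unit p).
Proof.
split; first by move=> k x y; rewrite /matrix_unit coordP // scalerDl scalerA.
by exists 1 => x; rewrite mul1r norm_matrix_unit.
Qed.

Lemma opnorm_matrix_unit p : opnorm (matrix_unit p) = 1.
Proof.
apply/eqP; rewrite eq_le; apply/andP; split.
  apply: opnorm_le => //; first exact: (matrix_unit_bounded p).1.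
  by move=> x; rewrite mul1r norm_matrix_unit.
have e0 := norm_basis_gt0 e_basis 0.
have := le_opnorm (e p.2) (matrix_unit_bounded p).
by rewrite matrix_unit_basis eqxx !(norm_basis e_sym _) ler_pMl.
Qed.

Lemma matrix_unit_positive p : positive_operator e (matrix_unit p).
Proof.
apply/(positive_operatorP e_basis e_sym (matrix_unit_bounded p)) => m n.
by rewrite matrix_unit_entry ler0n.
Qed.

Lemma op_entry_ext (a b : E -> E) : bounded_operator a -> bounded_operator b ->
  (forall m n, coord m (a (e n)) = coord m (b (e n))) -> a = b.
Proof.
move=> ab bb e_ab; apply: op_ext => // n.
by apply: (coord_ext e_basis) => m; exact: e_ab.
Qed.

Lemma matrix_unitD_bounded p q : bounded_operator (matrix_unit p + matrix_unit q).
Proof.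
rewrite -[matrix_unit p]scale1r; apply: bounded_operatorZD;
exact: matrix_unit_bounded.
Qed.

(** With distinct rows and distinct columns, the sum is a partial translation on a domain of two
    points. *)
Lemma opnorm_matrix_unitD_le p q : p.1 != q.1 -> p.2 != q.2 ->
  opnorm (matrix_unit p + matrix_unit q) <= 1.
Proof.
move=> pq1 pq2; pose D := pred2 p.2 q.2.
pose s n := if n == p.2 then p.1 else q.1.
have sinj : {in D &, injective s}.
  move=> m n; rewrite !inE /s => /orP[]/eqP -> /orP[]/eqP ->;
  rewrite ?eqxx //= ?[q.2 == p.2]eq_sym ?(negbTE pq2) //.
    by move=> pq; rewrite pq eqxx in pq1.
  by move=> pq; rewrite pq eqxx in pq1.
suff -> : matrix_unit p + matrix_unit q = translation D s.
  exact: opnorm_translation.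
apply: (op_ext e_basis) => [||n]; [exact: matrix_unitD_bounded|exact: translation_bounded|].
rewrite translation_basis // fctE !matrix_unit_basis /D /s /= ![n == _]eq_sym.
case: (eqVneq p.2 n) => [pn|_] /=; last by rewrite add0r.
by rewrite -pn [q.2 == _]eq_sym (negbTE pq2) addr0.
Qed.

Hypothesis E_sc : strictly_convex E.

Lemma strictly_convexP (r : R) x y : 0 < r -> rnorm x = r -> rnorm y = r ->
  x <> y -> rnorm (x + y) < 2 * r.
Proof.
move=> r0 xr yr xy; pose t : R[i] := ((r^-1)%:C)%C.
have tE : cabs t = r^-1 by rewrite cabs_real // invr_ge0 ltW.
have t0 : t != 0.
  by apply/eqP => t0; move: tE; rewrite t0 /cabs normr0 /=; have := invr_gt0 r; lra.
rewrite -ltr_pdivrMr // mulrC -tE -rnormZ scalerDr; apply: E_sc.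
- by rewrite rnormZ tE xr mulVf ?gt_eqF.
- by rewrite rnormZ tE yr mulVf ?gt_eqF.
- by move/(scalerI t0).
Qed.

Lemma basis_inj : injective e.
Proof.
move=> m n emn; have := coord_basis e_basis m n.
by rewrite -emn coord_basis // eqxx; case: eqP => // _ /eqP; rewrite oner_eq0.
Qed.

Lemma norm_basisD_lt i j : i != j -> rnorm (e i + e j) < 2 * rnorm (e 0%N).
Proof.
move=> ij; apply: strictly_convexP; rewrite ?norm_basis ?norm_basis_gt0 //.
by move=> /basis_inj /eqP; rewrite (negbTE ij).
Qed.

(* By unconditionality [e i + e j] and [e i - e j] have the same norm. *)
Lemma norm_basisD_gt i j : i != j -> rnorm (e 0%N) < rnorm (e i + e j).
Proof.
move=> ij; have ji : (j == i) = false by rewrite eq_sym (negbTE ij).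
have flip : rnorm (e i - e j) = rnorm (e i + e j).
  apply/eqP; rewrite eq_le; apply/andP; split; apply: norm_coord_mono => // n;
  rewrite coordB // coordD // !coord_basis //;
  by case: (eqVneq n i) => [->|_]; rewrite ?(negbTE ij) ?subr0 ?addr0 ?sub0r ?add0r ?normrN.
have ij0 : 0 < rnorm (e i + e j).
  rewrite lt_def rnorm_ge0 andbT; apply/eqP => /rnorm0_eq0 /(congr1 (coord i)).
  rewrite coordD // !coord_basis // eqxx (negbTE ij) addr0 coord0 // => /eqP.
  by rewrite oner_eq0.
(* Strict convexity for two distinct vectors of equal norm, whose sum is twice [e i]. *)
have : rnorm ((e i + e j) + (e i - e j)) < 2 * rnorm (e i + e j).
  apply: strictly_convexP => // /(congr1 (coord j)).
  rewrite coordD // coordB // !coord_basis // eqxx ji add0r sub0r => /eqP.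
  by rewrite -subr_eq0 opprK -natrD pnatr_eq0.
rewrite addrACA subrr addr0 -mulr2n -scaler_nat rnormZ norm_basis //.
have -> : cabs (2%:R : R[i]) = 2.
  by rewrite -[2%:R](rmorph_nat (real_complex R)) cabs_real.
by rewrite ltr_pM2l.
Qed.

(** In a common row, [e j + e l] is sent to twice [e i], which is longer by [norm_basisD_lt]. In a
    common column, [e j] is sent to [e i + e k], which is longer by [norm_basisD_gt]. *)
Lemma opnorm_matrix_unitD_gt p q : p != q -> (p.1 == q.1) || (p.2 == q.2) ->
  1 < opnorm (matrix_unit p + matrix_unit q).
Proof.
case: p q => i j [k l]; have e0 := norm_basis_gt0 e_basis 0.
rewrite xpair_eqE /= => pq /orP[/eqP ik|/eqP jl].
  have jl : j != l by move: pq; rewrite ik eqxx.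
  have := le_opnorm (e j + e l) (matrix_unitD_bounded (i, j) (k, l)).
  rewrite fctE /matrix_unit /= !coordD // !coord_basis // !eqxx.
  rewrite (negbTE jl) [l == j]eq_sym (negbTE jl) addr0 add0r !scale1r -ik.
  rewrite -mulr2n -scaler_nat rnormZ norm_basis //.
  have -> : cabs (2%:R : R[i]) = 2.
    by rewrite -[2%:R](rmorph_nat (real_complex R)) cabs_real.
  move=> le; have lt := norm_basisD_lt jl; have ge := norm_basisD_gt jl.
  rewrite ltNge; apply/negP => op1.
  have := ler_wpM2r (rnorm_ge0 (e j + e l)) op1.
  by rewrite mul1r => /(le_trans le); rewrite leNgt lt.
have ik : i != k by move: pq; rewrite jl eqxx andbT.
have := le_opnorm (e j) (matrix_unitD_bounded (i, j) (k, l)).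
rewrite fctE !matrix_unit_basis /= jl eqxx norm_basis // => le.
rewrite ltNge; apply/negP => op1.
have := ler_wpM2r (ltW e0) op1; rewrite mul1r => /(le_trans le).
by rewrite leNgt norm_basisD_gt.
Qed.

End PartialTranslations.

(** * Linear structure and elements of the uniform Roe algebra *)

Section RoeAlgebra.
Context {R : realType} {E : completeNormedModType R[i]} {e : nat -> E}.
Context {d : nat -> nat -> R}.
Hypotheses (e_basis : schauder_basis e) (e_sym : one_symmetric e).

Local Notation coord := (biorthogonal e).
Local Notation A := (uniform_roe_algebra d e).

Lemma roe_bounded a : A a -> bounded_operator a.
Proof. by case. Qed.

Lemma band_roe a : band_operators d e a -> A a.
Proof.
move=> ab; split=> [|eps eps0]; first exact: ab.1.
exists a => //; apply: le_lt_trans eps0; apply: opnorm_le => //.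
  by move=> k x y; rewrite /= !subrr scaler0 addr0.
by move=> x; rewrite /= subrr rnorm0 mul0r.
Qed.

Lemma band_operatorZD k a b : band_operators d e a -> band_operators d e b ->
  band_operators d e (k *: a + b).
Proof.
move=> [ab [r r0 ar]] [bb [s s0 bs]]; split; first exact: bounded_operatorZD.
exists (Num.max r s) => [|n m]; first by rewrite lt_max r0.
rewrite gt_max => /andP[/ar am /bs bm].
by rewrite fctE coordD // coordZ // am bm mulr0 addr0.
Qed.

Lemma roeZD k a b : A a -> A b -> A (k *: a + b).
Proof.
move=> [ab aA] [bb bA]; split=> [|eps eps0]; first exact: bounded_operatorZD.
have k1 : 0 < cabs k + 1 by rewrite ltr_wpDl // cabs_ge0.
have /aA[a' a'A aa'] : 0 < eps / 2 / (cabs k + 1) by rewrite !divr_gt0.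
have /bA[b' b'A bb'] : 0 < eps / 2 by rewrite divr_gt0.
exists (k *: a' + b'); first exact: band_operatorZD.
have sub_bounded (c c' : E -> E) :
    bounded_operator c -> bounded_operator c' -> bounded_operator (c \- c').
  move=> cb c'b; have := bounded_operatorZD (-1) c'b cb.
  by congr bounded_operator; apply/funext => x; rewrite !fctE /= scaleN1r addrC.
have aa'b := sub_bounded _ _ ab a'A.1; have bb'b := sub_bounded _ _ bb b'A.1.
have -> : (k *: a + b) \- (k *: a' + b') = k *: (a \- a') + (b \- b').
  by apply/funext => x; rewrite /= !fctE /= scalerBr opprD addrACA.
apply: le_lt_trans (opnormZD k aa'b bb'b) _; rewrite (splitr eps) ler_ltD //.
have {}aa' := ltW aa'; rewrite ler_pdivlMr // in aa'; apply: le_trans aa'.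
by rewrite mulrC ler_wpM2l ?opnorm_ge0 // lerDl.
Qed.

Lemma roe0 : A 0.
Proof.
apply: band_roe; split; first exact: bounded_operator0.
by exists 1 => // n m _; rewrite coord0.
Qed.

Lemma roeZ k a : A a -> A (k *: a).
Proof. by rewrite -[k *: a]addr0 => aA; exact: roeZD aA roe0. Qed.

Lemma roeD a b : A a -> A b -> A (a + b).
Proof. by rewrite -{2}[a]scale1r; exact: roeZD. Qed.

Lemma roeB a b : A a -> A b -> A (a - b).
Proof. by move=> aA bA; rewrite addrC -scaleN1r; exact: roeZD. Qed.

Lemma roe_translation (D : pred nat) (s : nat -> nat) (r : R) :
  {in D &, injective s} -> 0 < r -> (forall n, D n -> d n (s n) <= r) ->
  A (translation (e := e) D s).
Proof.
move=> sinj r0 Ds; apply: band_roe; split; first exact: translation_bounded.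
exists r => // n m dnm; rewrite translation_basis //.
case: ifPn => [/Ds dns|_]; last by rewrite coord0.
rewrite coord_basis //; case: eqP => // ms.
by move: dns; rewrite -ms leNgt dnm.
Qed.

Lemma roe_matrix_unit p : A (matrix_unit (e := e) p).
Proof.
apply: band_roe; split; first exact: matrix_unit_bounded.
(* Any positive radius at least [d p.2 p.1] serves; this one is positive without appeal to the
   metric axioms. *)
exists (`|d p.2 p.1| + 1) => [|n m dnm]; first by rewrite ltr_wpDl.
rewrite matrix_unit_entry //; case: eqP => // mnp; move: dnm; rewrite -mnp /=.
by rewrite ltNge (le_trans (ler_norm _)) // lerDl.
Qed.

(** Far entries of an approximating band operator vanish, and each entry of the difference is at
    most its operator norm. *)
Lemma roe_entry_small a (eps : R) : A a -> 0 < eps ->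
  exists2 r : R, 0 < r & forall m n, r < d n m -> cabs (coord m (a (e n))) < eps.
Proof.
move=> [ab aA] /aA[b [bb [r r0 br]] lt_eps]; exists r => // m n /br bmn.
apply: le_lt_trans lt_eps.
have abb : bounded_operator (a \- b).
  have := bounded_operatorZD (-1) bb ab.
  by congr bounded_operator; apply/funext => x; rewrite !fctE /= scaleN1r addrC.
have := entry_le_opnorm e_basis e_sym m n abb.
by rewrite /= coordB // bmn subr0.
Qed.

End RoeAlgebra.

(** * Automorphisms of the infinite rook's graph *)

Section RookGraph.
Implicit Types (p q : nat * nat) (sigma tau : nat * nat -> nat * nat).

(** Adjacency in the rook's graph, except that every position is also collinear with itself. *)
Definition collinear p q : bool := (p.1 == q.1) || (p.2 == q.2).

Lemma collinear_swap p q : collinear (swap_pair p) (swap_pair q) = collinear p q.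
Proof. exact: orbC. Qed.

(** A point off the common row would share its column with both [l 0] and [l 1], which would then
    coincide. *)
Lemma clique_row (l : nat -> nat * nat) : injective l ->
  (forall i j, i != j -> collinear (l i) (l j)) -> (l 0%N).1 = (l 1%N).1 ->
  forall i, (l i).1 = (l 0%N).1.
Proof.
move=> linj lP l01 i; apply/eqP/negPn/negP => li0.
have i0 : i != 0%N by apply: contraNneq li0 => ->.
have i1 : i != 1%N by apply: contraNneq li0 => ->; rewrite l01.
have := lP _ _ i0; rewrite /collinear (negbTE li0) /= => /eqP li2.
have := lP _ _ i1; rewrite /collinear -l01 (negbTE li0) /= => /eqP li2'.
suff /linj : l 0%N = l 1%N by [].
by rewrite [l 0%N]surjective_pairing [l 1%N]surjective_pairing l01 -li2 -li2'.
Qed.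

(** The first two points decide the direction of the line; the column case is the row case after
    [swap_pair]. *)
Lemma clique_line (l : nat -> nat * nat) : injective l ->
  (forall i j, i != j -> collinear (l i) (l j)) ->
  (forall i j, (l i).1 = (l j).1) \/ (forall i j, (l i).2 = (l j).2).
Proof.
move=> linj lP; have /orP[/eqP l01|/eqP l01] : collinear (l 0%N) (l 1%N) by exact: lP.
  by left=> i j; rewrite !(clique_row linj lP l01 _).
have slinj : injective (swap_pair \o l) by apply: inj_comp linj; exact: can_inj swap_pairK.
have slP i j : i != j -> collinear ((swap_pair \o l) i) ((swap_pair \o l) j).
  by rewrite collinear_swap; exact: lP.
have slE i : (l i).2 = (l 0%N).2 := clique_row slinj slP l01 i.
by right=> i j; rewrite !slE.
Qed.

(** Lines are cliques, so they are mapped into lines. Once row [0] goes into a row, a column going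
    into a row, or another row going into a column, would make two non-collinear positions
    collinear. *)
Lemma rook_product sigma : injective sigma ->
  (forall p q, p != q -> collinear (sigma p) (sigma q) = collinear p q) ->
  (forall j j', (sigma (0%N, j)).1 = (sigma (0%N, j')).1) ->
  forall i j, sigma (i, j) = ((sigma (i, 0%N)).1, (sigma (0%N, j)).2).
Proof.
move=> sinj sP row0.
have apart i j i' j' : i != i' -> j != j' ->
    ~~ collinear (sigma (i, j)) (sigma (i', j')).
  move=> ii' jj'; rewrite sP ?xpair_eqE /collinear /= ?negb_and ?ii' //.
  by rewrite (negbTE ii') (negbTE jj').
have col i i' j : (sigma (i, j)).2 = (sigma (i', j)).2.
  have linj : injective (fun i => sigma (i, j)) by move=> a b /sinj[].
  have lP a b : a != b -> collinear (sigma (a, j)) (sigma (b, j)).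
    by move=> ab; rewrite sP ?xpair_eqE ?(negbTE ab) // /collinear eqxx orbT.
  have [row|//] := clique_line linj lP.
  (* If column [j] went into a row, it would be the row containing the image of row [0], so the
     images of [(1, j)] and [(0, j.+1)] would be collinear. *)
  have := apart 1%N j 0%N j.+1 isT; rewrite ltn_eqF // => /(_ isT).
  by rewrite /collinear (row 1%N 0%N) (row0 j j.+1) eqxx.
have row i j j' : (sigma (i, j)).1 = (sigma (i, j')).1.
  have linj : injective (fun j => sigma (i, j)) by move=> a b /sinj[].
  have lP a b : a != b -> collinear (sigma (i, a)) (sigma (i, b)).
    by move=> ab; rewrite sP ?xpair_eqE ?(negbTE ab) ?andbF // /collinear eqxx.
  have [//|coli] := clique_line linj lP.
  have [->|i0] := eqVneq i 0%N; first exact: row0.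
  have := apart i 0%N 0%N 1%N i0 isT.
  by rewrite /collinear (coli 0%N 1%N) (col i 0%N 1%N) eqxx orbT.
by move=> i j; rewrite [LHS]surjective_pairing (row i j 0%N) (col i 0%N j).
Qed.

Lemma product_inverse sigma tau (al be : nat -> nat) :
  cancel sigma tau -> cancel tau sigma ->
  (forall i j, sigma (i, j) = (al i, be j)) ->
  exists al' be' : nat -> nat,
    [/\ cancel al al', cancel al' al & forall k l, tau (k, l) = (al' k, be' l)].
Proof.
move=> sK tK sE.
have tE k l i j : sigma (i, j) = (k, l) -> tau (k, l) = (i, j) by move=> <-.
have stE k l : (al (tau (k, l)).1, be (tau (k, l)).2) = (k, l).
  by rewrite -sE -surjective_pairing tK.
exists (fun k => (tau (k, 0%N)).1), (fun l => (tau (0%N, l)).2).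
have alK k l : al (tau (k, l)).1 = k by have [] := stE k l.
have beK k l : be (tau (k, l)).2 = l by have [] := stE k l.
split=> // [i|k l]; last by apply: tE; rewrite sE alK beK.
(* The second coordinate is chosen so that [be] sends it to [0]; hence [sigma] sends this point to
   [(al i, 0)]. *)
by rewrite (tE _ _ i (tau (0%N, 0%N)).2) // sE beK.
Qed.

(** If row [0] goes into a column, composing with the transposition of the target reduces to the
    product case. *)
Lemma rook_automorphism sigma tau : cancel sigma tau -> cancel tau sigma ->
  (forall p q, p != q -> collinear (sigma p) (sigma q) = collinear p q) ->
  exists al be al' be' : nat -> nat, [/\ cancel al al', cancel al' al &
    (forall i j, sigma (i, j) = (al i, be j)) /\
    (forall k l, tau (k, l) = (al' k, be' l)) \/
    (forall i j, sigma (i, j) = (be j, al i)) /\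
    (forall k l, tau (k, l) = (al' l, be' k))].
Proof.
move=> sK tK sP; have sinj := can_inj sK.
have linj : injective (fun j => sigma (0%N, j)) by move=> a b /sinj[].
have lP a b : a != b -> collinear (sigma (0%N, a)) (sigma (0%N, b)).
  by move=> ab; rewrite sP // /collinear eqxx.
have [row0|col0] := clique_line linj lP.
  have sE := rook_product sinj sP row0.
  have [al' [be' [aK a'K tE]]] := product_inverse sK tK sE.
  exists (fun i => (sigma (i, 0%N)).1), (fun j => (sigma (0%N, j)).2), al', be'.
  by split=> //; left.
pose sigma' := swap_pair \o sigma; pose tau' := tau \o swap_pair.
have s'K : cancel sigma' tau' by move=> p; rewrite /sigma' /tau' /= swap_pairK sK.
have t'K : cancel tau' sigma' by move=> p; rewrite /sigma' /tau' /= tK swap_pairK.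
have s'P p q : p != q -> collinear (sigma' p) (sigma' q) = collinear p q.
  by rewrite collinear_swap; exact: sP.
have sE := rook_product (can_inj s'K) s'P col0.
have [al' [be' [aK a'K tE]]] := product_inverse s'K t'K sE.
exists (fun i => (sigma' (i, 0%N)).1), (fun j => (sigma' (0%N, j)).2), al', be'.
split=> //; right; split=> [i j|k l]; last exact: (tE l k).
by rewrite -[LHS]swap_pairK -[swap_pair (sigma _)]/(sigma' (i, j)) sE.
Qed.

End RookGraph.

(** * Coarseness tested on partial injections of bounded displacement *)

Section CoarseCriterion.
Context {R : realType} {d d' : nat -> nat -> R} {al : nat -> nat}.
Hypotheses (d_metric : is_metric d) (d'_metric : is_metric d').
Hypothesis d_ulf : uniformly_locally_finite d.

Lemma ball_bounded (r : R) x : 0 < r -> exists K, forall y, d x y <= r -> (y < K)%N.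
Proof.
move=> /d_ulf[N /(_ x) xN].
have fin : finite_set [set y | d x y <= r].
  by apply: card_le_finite xN _; exact: finite_II.
have [l lE] := (finite_seqP _).1 fin; exists (\max_(y <- l) y).+1 => y xy.
have yl : y \in l by have : [set y | d x y <= r] y by []; rewrite lE.
by rewrite ltnS (@leq_bigmax_seq _ _ _ id).
Qed.

(* Only finitely many pairs at distance at most [r] meet a given finite set, so
   far apart images are found on pairs avoiding it. *)
Lemma not_coarse_pairs (r : R) : 0 < r ->
  (forall s, 0 < s -> exists x y, d x y < r /\ s <= d' (al x) (al y)) ->
  forall M : nat, exists p : nat * nat,
    [/\ (M <= p.1)%N, (M <= p.2)%N, d p.1 p.2 <= r &
        M%:R <= d' (al p.1) (al p.2)].
Proof.
move=> r0 far M.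
have bound1 x : exists C : R, forall y, d x y <= r -> d' (al x) (al y) <= C.
  have [K xK] := ball_bounded x r0.
  exists (\sum_(y < K) `|d' (al x) (al y)|) => y /xK yK.
  apply: le_trans (ler_norm _) _.
  by rewrite (bigD1 (Ordinal yK)) //= lerDl sumr_ge0.
have [C xC] := choice bound1.
(* [S] bounds the image distance of every pair within [r] whose first point is below [M]. *)
pose S : R := \sum_(x < M) `|C x|.
have bound x y : (x < M)%N -> d x y <= r -> d' (al x) (al y) <= S.
  move=> xM xy; apply: le_trans (xC _ _ xy) _; apply: le_trans (ler_norm _) _.
  by rewrite /S (bigD1 (Ordinal xM)) //= lerDl sumr_ge0.
have S0 : 0 <= S by exact: sumr_ge0.
(* Exceeding [S] excludes points below [M], for [y] by symmetry of the metrics; the summand [M%:R]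
   makes the images far apart. *)
have [|x [y [/ltW xy sxy]]] := far (S + M%:R + 1).
  by rewrite ltr_wpDl // addr_ge0.
have M0 : 0 <= M%:R :> R by [].
exists (x, y); split => //=; last by lra.
  rewrite leqNgt; apply/negP => xM.
  by have := bound _ _ xM xy; lra.
rewrite leqNgt; apply/negP => yM.
have := bound y x yM; rewrite (Defs.metric_sym d_metric) => /(_ xy).
by rewrite (Defs.metric_sym d'_metric); lra.
Qed.

(** If [al] is not coarse, there are pairs [(x k, y k)] in disjoint blocks, at distance at most [r],
    with image distances tending to infinity. Sending [x k] to [y k] is then a partial injection
    contradicting the hypothesis. *)
Lemma coarse_partial_injections :
  (forall (D : pred nat) (s : nat -> nat) (r : R), {in D &, injective s} ->
    0 < r -> (forall n, D n -> d n (s n) <= r) ->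
    exists r', forall n, D n -> d' (al n) (al (s n)) <= r') ->
  coarse_map d d' al.
Proof.
move=> alP r r0; apply: contrapT => ncoarse.
have far s : 0 < s -> exists x y, d x y < r /\ s <= d' (al x) (al y).
  move=> s0; apply: contrapT => near_s; apply: ncoarse; exists s => // x y xy.
  by rewrite ltNge; apply/negP => sxy; apply: near_s; exists x, y.
have [g gP] := choice (not_coarse_pairs r0 far).
(* The next threshold exceeds both members of the current pair, so the [k]-th pair lies between
   [M k] and [M k.+1]. *)
pose M k := iter k (fun m => (maxn (g m).1 (g m).2).+1) 0%N.
pose x k := (g (M k)).1; pose y k := (g (M k)).2.
have Mx k : (M k <= x k)%N by have [] := gP (M k).
have My k : (M k <= y k)%N by have [] := gP (M k).
have xM k : (x k < M k.+1)%N by rewrite /M iterS ltnS leq_maxl.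
have yM k : (y k < M k.+1)%N by rewrite /M iterS ltnS leq_maxr.
have Mmono : {homo M : k l / (k <= l)%N}.
  by apply: homo_leq => // [|k]; [exact: leq_trans|exact: leq_trans (Mx k) (ltnW (xM k))].
have kM k : (k <= M k)%N.
  by elim: k => // k IH; rewrite (leq_ltn_trans IH) // (leq_ltn_trans (Mx k)).
have inj (z : nat -> nat) : (forall k, M k <= z k)%N ->
    (forall k, z k < M k.+1)%N -> injective z.
  move=> Mz zM; have zlt k l : (k < l)%N -> (z k < z l)%N.
    by move=> kl; rewrite (leq_trans (zM k)) // (leq_trans (Mmono _ _ kl)).
  move=> k l zkl; have [kl|lk|//] := ltngtP k l.
    by have := zlt _ _ kl; rewrite zkl ltnn.
  by have := zlt _ _ lk; rewrite zkl ltnn.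
have xinj := inj x Mx xM; have yinj := inj y My yM.
pose D : pred nat := fun n => `[< exists k, x k = n >].
(* [xget] inverts [x] on its range [D]; the default matters only outside [D]. *)
pose s n := y (xget 0%N [set k | x k = n]).
have sx k : s (x k) = y k.
  rewrite /s; congr y; apply: xinj.
  by have := @xgetI _ 0%N [set k' | x k' = x k] k erefl.
have sinj : {in D &, injective s}.
  by move=> _ _ /asboolP[k <-] /asboolP[l <-]; rewrite !sx => /yinj ->.
have [|r' r'P] := alP D s r sinj r0.
  by move=> _ /asboolP[k <-]; rewrite sx; have [] := gP (M k).
(* The image distance of the [k]-th pair is at least [M k], hence at least [k], and this [k] exceeds
   [r']. *)
pose k := (Num.truncn `|r'|).+1.
have Dx : D (x k) by apply/asboolP; exists k.
have := r'P _ Dx; rewrite sx.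
have [_ _ _ far_k] := gP (M k).
move/(le_trans far_k); apply/negP; rewrite -ltNge.
apply: le_lt_trans (ler_norm r') _.
apply: lt_le_trans (truncnS_gt _) _.
by rewrite ler_nat.
Qed.

End CoarseCriterion.

(* An isometric order isomorphism consists of two such records, with [Phi] and
   [Psi] exchanged. *)
Record isometric_embedding {R : realType} {E F : completeNormedModType R[i]}
    (d d' : nat -> nat -> R) (e : nat -> E) (f : nat -> F)
    (Phi : (E -> E) -> F -> F) (Psi : (F -> F) -> E -> E) : Prop := {
  emb_linear : linear_on (uniform_roe_algebra d e) Phi ;
  emb_roe : forall a,
    uniform_roe_algebra d e a -> uniform_roe_algebra d' f (Phi a) ;
  emb_positive : positive_on e f (uniform_roe_algebra d e) Phi ;
  emb_opnorm : isometry_on (uniform_roe_algebra d e) Phi ;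
  embK : forall a, uniform_roe_algebra d e a -> Psi (Phi a) = a }.

(** * Linearity rules on the Roe algebra *)

Section EmbeddingLinear.
Context {R : realType} {E F : completeNormedModType R[i]}.
Context {d d' : nat -> nat -> R} {e : nat -> E} {f : nat -> F}.
Context {Phi : (E -> E) -> F -> F} {Psi : (F -> F) -> E -> E}.
Hypotheses (e_basis : schauder_basis e).
Hypothesis Phi_emb : isometric_embedding d d' e f Phi Psi.
Local Notation A := (uniform_roe_algebra d e).

Lemma emb0 : Phi 0 = 0.
Proof.
have := emb_linear Phi_emb (-1) (roe0 e_basis) (roe0 e_basis).
by rewrite scaler0 addr0 scaleN1r addNr.
Qed.

Lemma embZ k a : A a -> Phi (k *: a) = k *: Phi a.
Proof.
move=> aA; have := emb_linear Phi_emb k aA (roe0 e_basis).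
by rewrite emb0 !addr0.
Qed.

Lemma embD a b : A a -> A b -> Phi (a + b) = Phi a + Phi b.
Proof. by move=> aA bA; have := emb_linear Phi_emb 1 aA bA; rewrite !scale1r. Qed.

Lemma embB a b : A a -> A b -> Phi (a - b) = Phi a - Phi b.
Proof.
move=> aA bA; have := emb_linear Phi_emb (-1) bA aA.
by rewrite !scaleN1r addrC [- Phi b + _]addrC.
Qed.

End EmbeddingLinear.

(** * The action of the isomorphism on matrix units *)

Section Isomorphism.
Context {R : realType} {E F : completeNormedModType R[i]}.
Context {d d' : nat -> nat -> R} {e : nat -> E} {f : nat -> F}.
Context {Phi : (E -> E) -> F -> F} {Psi : (F -> F) -> E -> E}.
Hypotheses (e_basis : schauder_basis e) (f_basis : schauder_basis f).
Hypotheses (e_sym : one_symmetric e) (f_sym : one_symmetric f).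
Hypothesis Phi_emb : isometric_embedding d d' e f Phi Psi.
Hypothesis Psi_emb : isometric_embedding d' d f e Psi Phi.

Local Notation A := (uniform_roe_algebra d e).
Local Notation B := (uniform_roe_algebra d' f).
Local Notation ue := (matrix_unit (e := e)).
Local Notation uf := (matrix_unit (e := f)).

(* Up to scaling, matrix units are the atoms of the cone of positive operators;
   the norm fixes the scalar. *)
Lemma emb_matrix_unit p : exists q, Phi (ue p) = uf q.
Proof.
have upA : A (ue p) := roe_matrix_unit (d := d) e_basis e_sym p.
set T := Phi (ue p); have TB : B T := emb_roe Phi_emb upA.
have Tb := roe_bounded TB.
have T1 : opnorm T = 1 by rewrite (emb_opnorm Phi_emb upA) opnorm_matrix_unit.
have upos : positive_operator e (ue p) by exact: matrix_unit_positive.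
have Tpos : positive_operator f T := emb_positive Phi_emb upA upos.
have T0 := (positive_operatorP f_basis f_sym Tb).1 Tpos.
(* An operator of norm one has a nonzero entry; its position is the candidate [q]. *)
have [k [l Tkl]] : exists k l, biorthogonal f k (T (f l)) != 0.
  apply: contrapT => Tnone.
  have TE : T = 0 *: T.
    apply: (op_entry_ext f_basis) => // [|m n]; first exact: bounded_operatorZ.
    rewrite fctE scale0r coord0 //; apply/eqP/negPn/negP => Tmn.
    by apply: Tnone; exists m, n.
  have := T1; rewrite TE opnormZ // /cabs normr0 mul0r => /esym/eqP.
  by rewrite oner_eq0.
set c := biorthogonal f k (T (f l)) in Tkl; pose q := (k, l).
have uqB : B (uf q) := roe_matrix_unit (d := d') f_basis f_sym q.
have bB : B (c *: uf q) := roeZ f_basis c uqB.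
have TcB : B (T - c *: uf q) := roeB f_basis TB bB.
have c0 : 0 <= c by exact: T0.
have bpos : positive_operator f (c *: uf q).
  apply/(positive_operatorP f_basis f_sym (roe_bounded bB)) => m n.
  by rewrite fctE coordZ // matrix_unit_entry // mulr_ge0 // ler0n.
(* Removing one entry of a positive operator leaves it positive, so [c *: uf q] lies below [T]. *)
have Tcpos : positive_operator f (T - c *: uf q).
  apply/(positive_operatorP f_basis f_sym (roe_bounded TcB)) => m n.
  rewrite !fctE coordB // coordZ // matrix_unit_entry //.
  by case: eqP => [[-> ->]|_]; rewrite ?mulr1 ?subrr // mulr0 subr0.
set b := Psi (c *: uf q); have bA : A b := emb_roe Psi_emb bB.
have bb := roe_bounded bA.
have b0 := (positive_operatorP e_basis e_sym bb).1
  (emb_positive Psi_emb bB bpos).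
have Psi_Tc : Psi (T - c *: uf q) = ue p - b.
  by rewrite (embB Psi_emb) // /T (embK Phi_emb).
have b_le : forall m n, 0 <= biorthogonal e m ((ue p - b) (e n)).
  rewrite -Psi_Tc; apply: (positive_operatorP e_basis e_sym _).1.
    exact: roe_bounded (emb_roe Psi_emb TcB).
  exact (emb_positive Psi_emb TcB Tcpos).
pose z := biorthogonal e p.1 (b (e p.2)).
(* Pulled back by [Psi], [b] lies between [0] and [ue p], so its entries away from [p] vanish. *)
have bE : b = z *: ue p.
  apply: (op_entry_ext e_basis) => // [|m n].
    exact: bounded_operatorZ (matrix_unit_bounded e_basis e_sym p).
  rewrite fctE coordZ // matrix_unit_entry //.
  case: eqP => [mnp|mnp]; first by rewrite mulr1 /z -mnp.
  have := b_le m n; rewrite !fctE coordB // matrix_unit_entry //.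
  case: eqP => // _; rewrite sub0r oppr_ge0 mulr0 => bmn.
  by apply/eqP; rewrite eq_le bmn b0.
have cTE : c *: uf q = z *: T.
  by rewrite -(embK Psi_emb bB) -/b bE (embZ e_basis Phi_emb).
have uqb := matrix_unit_bounded f_basis f_sym q.
(* Both [T] and [uf q] have norm one, so the scalars have equal modulus; being nonnegative, they are
   equal and cancel. *)
have : `|c| = `|z|.
  rewrite !norm_cabs; congr (real_complex R _).
  have := opnormZ z Tb; rewrite -cTE opnormZ // T1 opnorm_matrix_unit //.
  by rewrite !mulr1.
rewrite !ger0_norm //; last exact: b0.
by move=> cz; exists q; apply: (scalerI Tkl); rewrite cTE cz.
Qed.

Lemma matrix_unit_inj : injective ue.
Proof.
move=> p q pq; have := matrix_unit_entry e_basis p p.1 p.2.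
rewrite pq matrix_unit_entry // -surjective_pairing eqxx.
by case: eqP => // _ /eqP; rewrite eq_sym oner_eq0.
Qed.

(** The entry condition says that [a] dominates [ue p]; positivity of the image of the difference
    gives the same for [Phi a] and [uf q]. *)
Lemma emb_entry a p q : Phi (ue p) = uf q -> A a -> positive_operator e a ->
  1 <= biorthogonal e p.1 (a (e p.2)) ->
  1 <= biorthogonal f q.1 (Phi a (f q.2)).
Proof.
move=> pq aA apos ap.
have upA : A (ue p) := roe_matrix_unit (d := d) e_basis e_sym p.
have auA : A (a - ue p) := roeB e_basis aA upA.
have aupos : positive_operator e (a - ue p).
  apply/(positive_operatorP e_basis e_sym (roe_bounded auA)) => m n.
  rewrite !fctE coordB // matrix_unit_entry //.
  case: eqP => [mnp|_]; last first.
    by rewrite subr0; exact: (positive_operatorP e_basis e_sym (roe_bounded aA)).1.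
  by rewrite subr_ge0; move: ap; rewrite -mnp.
have := (positive_operatorP f_basis f_sym (roe_bounded (emb_roe Phi_emb auA))).1
  (emb_positive Phi_emb auA aupos) q.1 q.2.
rewrite (embB Phi_emb) // pq fctE coordB // matrix_unit_entry //.
by rewrite -surjective_pairing eqxx subr_ge0.
Qed.

(** The image of the translation along [s] has entries at least [1] at the positions
    [sigma (s n, n)], while its entries beyond some distance [r'] from the diagonal are below
    [1]. *)
Lemma emb_displacement (sigma : nat * nat -> nat * nat) :
  (forall p, Phi (ue p) = uf (sigma p)) ->
  forall (D : pred nat) (s : nat -> nat) (r : R), {in D &, injective s} ->
    0 < r -> (forall n, D n -> d n (s n) <= r) ->
    exists r', forall n, D n -> d' (sigma (s n, n)).2 (sigma (s n, n)).1 <= r'.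
Proof.
move=> sigmaP D s r sinj r0 Ds; set a := translation (e := e) D s.
have aA : A a by exact: roe_translation r0 Ds.
have apos : positive_operator e a.
  apply/(positive_operatorP e_basis e_sym (roe_bounded aA)) => m n.
  rewrite /a translation_basis //; case: (D n); last by rewrite coord0.
  by rewrite coord_basis // ler0n.
have [r' _ r'P] := roe_entry_small f_basis f_sym (emb_roe Phi_emb aA) ltr01.
exists r' => n Dn; rewrite leNgt; apply/negP => /r'P.
have := emb_entry (sigmaP (s n, n)) aA apos.
rewrite /a translation_basis // Dn coord_basis // eqxx => /(_ (lexx _)).
move=> h1; have h0 := le_trans ler01 h1.
by rewrite ltNge -lecR -norm_cabs ger0_norm // h1.
Qed.

Hypotheses (E_sc : strictly_convex E) (F_sc : strictly_convex F).

(** Whether the norm of a sum of two distinct matrix units exceeds [1] detects collinearity, and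
    [Phi] preserves this norm. *)
Lemma emb_collinear (sigma : nat * nat -> nat * nat) :
  injective sigma -> (forall p, Phi (ue p) = uf (sigma p)) ->
  forall p q, p != q -> collinear (sigma p) (sigma q) = collinear p q.
Proof.
move=> sinj sigmaP p q pq; have spq : sigma p != sigma q by rewrite (inj_eq sinj).
have upA := roe_matrix_unit (d := d) e_basis e_sym p.
have uqA := roe_matrix_unit (d := d) e_basis e_sym q.
have := emb_opnorm Phi_emb (roeD e_basis upA uqA).
rewrite (embD Phi_emb) // !sigmaP => normE.
have [pq_col|] := boolP (collinear p q).
  have := opnorm_matrix_unitD_gt e_basis e_sym E_sc pq pq_col; rewrite -normE.
  apply: contraTT; rewrite negb_or => /andP[s1 s2].
  by rewrite -leNgt opnorm_matrix_unitD_le.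
rewrite negb_or => /andP[s1 s2].
have := opnorm_matrix_unitD_le e_basis e_sym s1 s2; rewrite -normE.
apply: contraTF => spq_col.
by rewrite -ltNge opnorm_matrix_unitD_gt.
Qed.

End Isomorphism.

(* The choice [s = id] shows that [al] and [be] are close. *)
Lemma product_coarse {R : realType} {d d' : nat -> nat -> R}
    (sigma : nat * nat -> nat * nat) (al be : nat -> nat) :
  is_metric d -> is_metric d' -> uniformly_locally_finite d ->
  (forall i j, sigma (i, j) = (al i, be j)) \/
    (forall i j, sigma (i, j) = (be j, al i)) ->
  (forall (D : pred nat) (s : nat -> nat) (r : R), {in D &, injective s} ->
    0 < r -> (forall n, D n -> d n (s n) <= r) ->
    exists r', forall n, D n -> d' (sigma (s n, n)).2 (sigma (s n, n)).1 <= r') ->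
  coarse_map d d' al /\ coarse_map d d' be.
Proof.
move=> dm d'm ulf sigmaE sigmaP.
have dE i j : d' (sigma (i, j)).2 (sigma (i, j)).1 = d' (be j) (al i).
  by case: sigmaE => ->//; rewrite (Defs.metric_sym d'm).
have [r0 close] : exists r, forall n, d' (be n) (al n) <= r.
  have [|r rP] := sigmaP predT id 1 (in2W (@inj_id nat)) ltr01.
    by move=> n _; rewrite ((Defs.metric_eq0 dm n n).2 erefl).
  by exists r => n; rewrite -dE; exact: rP.
split; apply: coarse_partial_injections => // D s r sinj r_gt0 Ds;
have [r' r'P] := sigmaP D s r sinj r_gt0 Ds; exists (r0 + r') => n Dn;
have := r'P n Dn; rewrite dE => far.
  (* The path from [al n] to [al (s n)] goes through [be n]; the one from [be n] to [be (s n)] below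
     goes through [al (s n)]. *)
  apply: le_trans (Defs.metric_triangle d'm _ (be n) _) _.
  by rewrite lerD // (Defs.metric_sym d'm).
apply: le_trans (Defs.metric_triangle d'm _ (al (s n)) _) _.
by rewrite addrC lerD // (Defs.metric_sym d'm).
Qed.

(** * The coarse equivalence obtained from the correspondence of matrix units *)

Theorem theorem1p2 (R : realType) (d d' : nat -> nat -> R)
    (E F : completeNormedModType (complex R)) (e : nat -> E) (f : nat -> F)
    (d_metric : is_metric d) (d'_metric : is_metric d')
    (d_ulf : uniformly_locally_finite d)
    (d'_ulf : uniformly_locally_finite d')
    (E_sc : strictly_convex E) (F_sc : strictly_convex F)
    (e_basis : schauder_basis e) (f_basis : schauder_basis f)
    (e_sym : one_symmetric e) (f_sym : one_symmetric f)
    (hPhi : order_isometric e f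
      (uniform_roe_algebra d e) (uniform_roe_algebra d' f)) :
  bijectively_coarsely_equivalent d d'.
Proof.
have [Phi [Phi_lin Phi_bij Phi_pos [Psi [Psi_bij PhiK PsiK Psi_pos]]] Phi_iso] := hPhi.
have PhiB a : uniform_roe_algebra d e a -> uniform_roe_algebra d' f (Phi a).
  by case: Phi_bij => h _ _; exact: h.
have PsiA b : uniform_roe_algebra d' f b -> uniform_roe_algebra d e (Psi b).
  by case: Psi_bij => h _ _; exact: h.
have Phi_emb : isometric_embedding d d' e f Phi Psi by split.
(* Linearity and isometry of [Psi] are transported from [Phi] through the two cancellation
   identities. *)
have Psi_emb : isometric_embedding d' d f e Psi Phi.
  split=> // [k a b aB bB|b bB]; last by rewrite -Phi_iso ?PsiK //; exact: PsiA.
  have <- := PhiK _ (roeZD e_basis k (PsiA _ aB) (PsiA _ bB)).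
  by rewrite Phi_lin ?PsiK //; exact: PsiA.
have [sigma sigmaP] := choice (emb_matrix_unit e_basis f_basis e_sym f_sym Phi_emb Psi_emb).
have [tau tauP] := choice (emb_matrix_unit f_basis e_basis f_sym e_sym Psi_emb Phi_emb).
have sK : cancel sigma tau.
  move=> p; apply: (matrix_unit_inj e_basis).
  by rewrite -tauP -sigmaP PhiK //; exact: roe_matrix_unit.
have tK : cancel tau sigma.
  move=> q; apply: (matrix_unit_inj f_basis).
  by rewrite -sigmaP -tauP PsiK //; exact: roe_matrix_unit.
have sP := emb_collinear e_basis f_basis e_sym f_sym Phi_emb E_sc F_sc (can_inj sK) sigmaP.
have disp_sigma := emb_displacement e_basis f_basis e_sym f_sym Phi_emb sigmaP.
have disp_tau := emb_displacement f_basis e_basis f_sym e_sym Psi_emb tauP.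
have [al [be [al' [be' [alK al'K stE]]]]] := rook_automorphism sK tK sP.
have al_coarse : coarse_map d d' al.
  apply: (product_coarse (be := be) d_metric d'_metric d_ulf _ disp_sigma).1.
  by case: stE => [[]|[]]; [left|right].
have al'_coarse : coarse_map d' d al'.
  case: stE => [[_ tE]|[_ tE]].
    by apply: (product_coarse (be := be') d'_metric d_metric d'_ulf _ disp_tau).1; left.
  (* In the transposed case [al'] acts on the second coordinate, so it takes the place of [be] and
     the second conclusion applies. *)
  by apply: (product_coarse (al := be') d'_metric d_metric d'_ulf _ disp_tau).2; right.
exists al; first by exists al'.
split; first split=> // s s0.
  (* Expansion of [al] is coarseness of its inverse; [s + 1] turns the bound [<= s] into a strict
     one. *)
  have [|r r0 rP] := al'_coarse (s + 1); first by rewrite ltr_wpDl // ltW.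
  exists r => // x y xy; rewrite ltNge; apply/negP => le_s.
  have := rP (al x) (al y); rewrite !alK => close.
  have /close/ltW : d' (al x) (al y) < s + 1 by rewrite (le_lt_trans le_s) // ltrDl.
  by rewrite leNgt xy.
(* Since [al] is onto, every point is at distance at most [0] from its range. *)
apply: (@le_lt_trans _ _ 0%E); last by rewrite ltry.
apply: ub_ereal_sup => _ [y _ <-]; apply: ereal_inf_lbound.
exists y; first by exists (al' y).
by rewrite ((Defs.metric_eq0 d'_metric y y).2 erefl).
Qed.
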